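(* Let $R$ be a $\phi$-ring. Then the following assertions are equivalent: (1) $R$ is a $\phi$-Prüfer ring. (2) The lattice formed by the nonnil ideals of $R$ is distributive, i.e., $I \cap (J+K) = (I \cap J) + (I \cap K)$ for any three nonnil ideals $I, J, K$ of $R$.
   Context: All rings are commutative with nonzero identity. For a ring $R$, $\mathrm{Nil}(R)$ denotes the ideal of nilpotent elements, $Z(R)$ the set of zerodivisors and $T(R)$ the total quotient ring. A prime ideal $P$ of $R$ is called divided if it is comparable (under inclusion) to every ideal of $R$. $R$ is a $\phi$-ring if $\mathrm{Nil}(R)$ is a divided prime ideal of $R$. An ideal $I$ of $R$ is nonnil if $I \not\subseteq \mathrm{Nil}(R)$. For a $\phi$-ring $R$, let $\phi: T(R) \to R_{\mathrm{Nil}(R)}$ be the ring homomorphism $\phi(a/b) = a/b$ for $a\in R$, $b \in R\setminus Z(R)$; restricted to $R$ it is the ring homomorphism $x \mapsto x/1$, with image the ring $\phi(R)$. A nonnil ideal $I$ of a $\phi$-ring $R$ is $\phi$-invertible if $\phi(I)$ is an invertible ideal of $\phi(R)$, i.e. $\phi(I)\,\phi(I)^{-1} = \phi(R)$ where $\phi(I)^{-1} = \{x \in T(\phi(R)) : x\phi(I) \subseteq \phi(R)\}$. A $\phi$-ring $R$ is $\phi$-Prüfer if every finitely generated nonnil ideal of $R$ is $\phi$-invertible. *)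

(* Defs.v *)
From HB Require Import structures.
From mathcomp Require Import all_boot all_algebra generic_quotient ring.
From mathcomp Require Import boolp classical_sets.

Set Implicit Arguments.
Unset Strict Implicit.
Unset Printing Implicit Defensive.

Import GRing.Theory.
Local Open Scope classical_set_scope.
Local Open Scope ring_scope.
Local Open Scope quotient_scope.

(* Commutative rings that may be zero ([comPzRingType]) are allowed in the
   generic constructions, because a localization may be the zero ring. *)

Section Localization.
Variables (A : comPzRingType) (S : mulrClosed A).

Definition den := {s : A | s \in S}.
Definition fraction := (A * den)%type.

Definition den1 : den := exist _ 1 (rpred1 S).
Definition denM (s t : den) : den :=
  exist _ (sval s * sval t) (rpredM (valP s) (valP t)).

(* The factor u is needed since S may contain zerodivisors. *)
Definition frac_eq (x y : fraction) : bool :=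
  `[< exists2 u : A, u \in S & u * (x.1 * sval y.2) = u * (y.1 * sval x.2) >].

Lemma frac_eq_refl : reflexive frac_eq.
Proof. by move=> x; apply/asboolP; exists 1; rewrite ?rpred1. Qed.

Lemma frac_eq_sym : symmetric frac_eq.
Proof.
by move=> x y; apply/asboolP/asboolP => -[u uS e]; exists u; rewrite ?e.
Qed.

Lemma frac_eq_trans : transitive frac_eq.
Proof.
move=> y x z /asboolP[u uS e] /asboolP[v vS f]; apply/asboolP.
exists (u * v * sval y.2); first by rewrite !rpredM ?(valP y.2).
transitivity (v * sval z.2 * (u * (x.1 * sval y.2))); first by ring.
transitivity (u * sval x.2 * (v * (y.1 * sval z.2))); last by rewrite f; ring.
by rewrite e; ring.
Qed.

Canonical frac_eq_equiv :=
  EquivRel frac_eq frac_eq_refl frac_eq_sym frac_eq_trans.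

Definition localization := {eq_quot frac_eq}.
HB.instance Definition _ := EqQuotient.on localization.
HB.instance Definition _ := Choice.on localization.

Definition mkfrac (a : A) (s : den) : localization := \pi_localization (a, s).

Lemma mkfracP a s b t : mkfrac a s = mkfrac b t <->
  exists2 u : A, u \in S & u * (a * sval t) = u * (b * sval s).
Proof. by split=> [/eqmodP/asboolP|h]; [|apply/eqmodP/asboolP]. Qed.

Lemma mkfracW (P : localization -> Prop) :
  (forall a s, P (mkfrac a s)) -> forall x, P x.
Proof. by move=> h; elim/quotW => -[]. Qed.

Definition loc0 : localization := mkfrac 0 den1.
Definition loc1 : localization := mkfrac 1 den1.
Definition loc_opp (x : localization) : localization :=
  mkfrac (- (repr x).1) (repr x).2.
Definition loc_add (x y : localization) : localization :=
  mkfrac ((repr x).1 * sval (repr y).2 + (repr y).1 * sval (repr x).2)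
         (denM (repr x).2 (repr y).2).
Definition loc_mul (x y : localization) : localization :=
  mkfrac ((repr x).1 * (repr y).1) (denM (repr x).2 (repr y).2).

Lemma repr_mkfrac a s : exists2 u : A, u \in S &
  u * ((repr (mkfrac a s)).1 * sval s) = u * (a * sval (repr (mkfrac a s)).2).
Proof.
by apply/mkfracP; rewrite /mkfrac -surjective_pairing reprK.
Qed.

Lemma loc_oppE a s : loc_opp (mkfrac a s) = mkfrac (- a) s.
Proof.
apply/mkfracP; have [u uS e] := repr_mkfrac a s.
by exists u; rewrite // !mulNr !mulrN e.
Qed.

Lemma loc_addE a s b t :
  loc_add (mkfrac a s) (mkfrac b t) =
  mkfrac (a * sval t + b * sval s) (denM s t).
Proof.
rewrite /loc_add; have [u uS] := repr_mkfrac a s.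
have [v vS] := repr_mkfrac b t.
case: (repr (mkfrac a s)) => a' s'; case: (repr (mkfrac b t)) => b' t' /=.
move=> f e; apply/mkfracP; exists (u * v); rewrite ?rpredM //=.
transitivity (v * sval t' * sval t * (u * (a' * sval s))
              + u * sval s' * sval s * (v * (b' * sval t))); first by ring.
by rewrite e f; ring.
Qed.

Lemma loc_mulE a s b t :
  loc_mul (mkfrac a s) (mkfrac b t) = mkfrac (a * b) (denM s t).
Proof.
rewrite /loc_mul; have [u uS] := repr_mkfrac a s.
have [v vS] := repr_mkfrac b t.
case: (repr (mkfrac a s)) => a' s'; case: (repr (mkfrac b t)) => b' t' /=.
move=> f e; apply/mkfracP; exists (u * v); rewrite ?rpredM //=.
transitivity ((u * (a' * sval s)) * (v * (b' * sval t))); first by ring.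
by rewrite e f; ring.
Qed.

Lemma mkfrac_eq a s b t : a * sval t = b * sval s -> mkfrac a s = mkfrac b t.
Proof. by move=> e; apply/mkfracP; exists 1; rewrite ?rpred1 ?e. Qed.

Lemma loc_addA : associative loc_add.
Proof.
elim/mkfracW => a s; elim/mkfracW => b t; elim/mkfracW => c u.
by rewrite !loc_addE; apply: mkfrac_eq => /=; ring.
Qed.

Lemma loc_addC : commutative loc_add.
Proof.
elim/mkfracW => a s; elim/mkfracW => b t; rewrite !loc_addE.
by apply: mkfrac_eq => /=; ring.
Qed.

Lemma loc_add0 : left_id loc0 loc_add.
Proof.
elim/mkfracW => a s; rewrite loc_addE; apply: mkfrac_eq => /=.
by rewrite mul0r add0r mulr1 mul1r.
Qed.

Lemma loc_addN : left_inverse loc0 loc_opp loc_add.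
Proof.
elim/mkfracW => a s; rewrite loc_oppE loc_addE; apply: mkfrac_eq => /=.
by rewrite mulNr addNr !mul0r.
Qed.

HB.instance Definition _ :=
  GRing.isZmodule.Build localization loc_addA loc_addC loc_add0 loc_addN.

Lemma loc_mulA : associative loc_mul.
Proof.
elim/mkfracW => a s; elim/mkfracW => b t; elim/mkfracW => c u.
by rewrite !loc_mulE; apply: mkfrac_eq => /=; rewrite !mulrA.
Qed.

Lemma loc_mulC : commutative loc_mul.
Proof.
elim/mkfracW => a s; elim/mkfracW => b t; rewrite !loc_mulE.
by apply: mkfrac_eq => /=; ring.
Qed.

Lemma loc_mul1 : left_id loc1 loc_mul.
Proof.
elim/mkfracW => a s; rewrite loc_mulE; apply: mkfrac_eq => /=.
by rewrite !mul1r.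
Qed.

Lemma loc_mulDl : left_distributive loc_mul loc_add.
Proof.
elim/mkfracW => a s; elim/mkfracW => b t; elim/mkfracW => c u.
by rewrite !(loc_addE, loc_mulE); apply: mkfrac_eq => /=; ring.
Qed.

HB.instance Definition _ := GRing.Zmodule_isComPzRing.Build localization
  loc_mulA loc_mulC loc_mul1 loc_mulDl.

Definition to_loc (a : A) : localization := mkfrac a den1.

Lemma to_loc_zmod : zmod_morphism to_loc.
Proof.
move=> a b; rewrite [RHS](_ : _ = loc_add (to_loc a) (loc_opp (to_loc b))) //.
by rewrite loc_oppE loc_addE; apply: mkfrac_eq => /=; ring.
Qed.

Lemma to_loc_monoid : monoid_morphism to_loc.
Proof.
split=> // a b; rewrite [RHS](_ : _ = loc_mul (to_loc a) (to_loc b)) //.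
by rewrite loc_mulE; apply: mkfrac_eq => /=; ring.
Qed.

HB.instance Definition _ :=
  GRing.isZmodMorphism.Build A localization to_loc to_loc_zmod.
HB.instance Definition _ :=
  GRing.isMonoidMorphism.Build A localization to_loc to_loc_monoid.

End Localization.

Arguments to_loc {A} S a.

Section ImageRing.
Variables (A B : comPzRingType) (f : {rmorphism A -> B}).

Definition in_image : {pred B} := [pred y | `[< exists x, f x = y >]].

Lemma in_image_subring : subring_closed in_image.
Proof.
split; first by apply/asboolP; exists 1; rewrite rmorph1.
  move=> _ _ /asboolP[x <-] /asboolP[y <-]; apply/asboolP.
  by exists (x - y); rewrite rmorphB.
move=> _ _ /asboolP[x <-] /asboolP[y <-]; apply/asboolP.
by exists (x * y); rewrite rmorphM.
Qed.

HB.instance Definition _ :=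
  GRing.isSubringClosed.Build B in_image in_image_subring.

Definition image_ring := {y : B | y \in in_image}.
HB.instance Definition _ := SubType.on image_ring.
HB.instance Definition _ := Choice.on image_ring.
HB.instance Definition _ :=
  GRing.SubChoice_isSubComPzRing.Build _ _ image_ring (subringClosedP _).

Lemma in_imageP x : f x \in in_image.
Proof. by apply/asboolP; exists x. Qed.

Definition to_image (x : A) : image_ring := exist _ (f x) (in_imageP x).

Lemma to_image_zmod : zmod_morphism to_image.
Proof. by move=> x y; apply: val_inj; rewrite rmorphB /= rmorphB. Qed.

Lemma to_image_monoid : monoid_morphism to_image.
Proof.
by split=> [|x y]; apply: val_inj; rewrite ?rmorph1 ?rmorphM /= ?rmorph1 ?rmorphM.
Qed.

HB.instance Definition _ :=
  GRing.isZmodMorphism.Build A image_ring to_image to_image_zmod.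
HB.instance Definition _ :=
  GRing.isMonoidMorphism.Build A image_ring to_image to_image_monoid.

End ImageRing.

Section Ideals.
Variable A : comPzRingType.

Definition is_ideal (I : set A) : Prop :=
  [/\ I 0, forall x y, I x -> I y -> I (x + y) &
      forall a x, I x -> I (a * x)].

Definition ideal_gen (s : seq A) : set A :=
  [set x | exists a : 'I_(size s) -> A, x = \sum_(i < size s) a i * s`_i].

Definition fin_gen (I : set A) : Prop := exists s : seq A, I = ideal_gen s.

Definition ideal_add (I J : set A) : set A :=
  [set x + y | x in I & y in J].

Definition prod_set (I J : set A) : set A :=
  [set z | exists (n : nat) (x y : 'I_n -> A),
    [/\ forall i, I (x i), forall i, J (y i) & z = \sum_(i < n) x i * y i]].

Definition prime_ideal (P : set A) : Prop :=
  [/\ is_ideal P, ~ P 1 & forall x y, P (x * y) -> P x \/ P y].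

Definition divided (P : set A) : Prop :=
  forall I : set A, is_ideal I -> P `<=` I \/ I `<=` P.

Definition nilradical : set A := [set x | exists n : nat, x ^+ n = 0].

Definition nonnil_ideal (I : set A) : Prop :=
  is_ideal I /\ ~ (I `<=` nilradical).

Definition zerodivisor : set A :=
  [set x | exists2 y : A, y <> 0 & x * y = 0].

Definition regular : {pred A} := [pred x | `[< ~ zerodivisor x >]].

Lemma regular_mulr_closed : mulr_closed regular.
Proof.
split; first by apply/asboolP => -[y y0]; rewrite mul1r.
move=> x y /asboolP hx /asboolP hy; apply/asboolP => -[z z0 e].
apply: hx; exists (y * z); last by rewrite mulrA.
by move=> yz0; apply: hy; exists z.
Qed.

HB.instance Definition _ :=
  GRing.isMulClosed.Build A regular regular_mulr_closed.

End Ideals.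

Arguments nilradical : clear implicits.
Arguments zerodivisor : clear implicits.
Arguments regular : clear implicits.

Section Invertible.
Variable A : comPzRingType.

Definition total_quotient : comPzRingType := localization (regular A).

Definition to_total_quotient : {rmorphism A -> total_quotient} :=
  to_loc (regular A).

Definition inv_ideal (I : set A) : set total_quotient :=
  [set x | forall a, I a ->
    exists b, x * to_total_quotient a = to_total_quotient b].

Definition invertible (I : set A) : Prop :=
  prod_set (to_total_quotient @` I) (inv_ideal I) = range to_total_quotient.

End Invertible.

Definition phi_ring (R : comNzRingType) : Prop :=
  prime_ideal (nilradical R) /\ divided (nilradical R).

Section PhiPrufer.
Variables (R : comNzRingType) (hR : phi_ring R).

(* [hR] is a phantom argument: it makes the set multiplicatively closed. *)
Definition nonnil_elt (_ : phi_ring R) : {pred R} :=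
  [pred x | `[< ~ nilradical R x >]].

Lemma nonnil_elt_mulr_closed : mulr_closed (nonnil_elt hR).
Proof.
have [[_ nil1 nilM] _] := hR; split; first exact/asboolP.
by move=> x y /asboolP hx /asboolP hy; apply/asboolP => /nilM[].
Qed.

HB.instance Definition _ :=
  GRing.isMulClosed.Build R (nonnil_elt hR) nonnil_elt_mulr_closed.

Definition loc_nil : comPzRingType := localization (nonnil_elt hR).

(* The restriction to R of the homomorphism T(R) -> R_Nil(R). *)
Definition phi_mor : {rmorphism R -> loc_nil} := to_loc (nonnil_elt hR).

Definition phi_image : comPzRingType := image_ring phi_mor.

Definition phi : {rmorphism R -> phi_image} := to_image phi_mor.

Definition phi_invertible (I : set R) : Prop :=
  nonnil_ideal I /\ invertible (phi @` I).

Definition phi_prufer : Prop :=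
  forall I : set R, fin_gen I -> nonnil_ideal I -> phi_invertible I.

End PhiPrufer.

Definition nonnil_ideals_distributive (R : comNzRingType) : Prop :=
  forall I J K : set R, nonnil_ideal I -> nonnil_ideal J -> nonnil_ideal K ->
    I `&` ideal_add J K = ideal_add (I `&` J) (I `&` K).

(* Main.v *)
Require Import Defs.
From mathcomp Require Import all_boot all_algebra.
From mathcomp Require Import ring boolp classical_sets.

(** Write N for the nilradical.  Since N is a divided prime, every nonnil ideal
    contains N; and the kernel of [phi] lies in N, while [phi] sends non-nilpotent
    elements to regular ones.  So an equality in phi(R) lifts to a congruence
    modulo N in R, the error terms of which are absorbed by any nonnil ideal, and
    every non-nilpotent element may serve as a denominator.  With this, the
    classical argument for Prüfer domains goes through.

    Prüfer implies distributive.  Let x = j + k be in I with j in J and k in K.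
    If x is not in N, the ideal (j, k) is nonnil and the invertibility of its
    image gives a, b, c, d in R with a + d = 1, a k = b j and d j = c k modulo N
    ([phi_invertible_pair]).  Then a x = (a + b) j modulo N lies in J, and
    d x = (c + d) k modulo N lies in K, so x = a x + d x modulo N is the required
    decomposition.

    Distributive implies Prüfer.  For non-nilpotent a, b, distributing (a) over
    (b) + (a - b), a sum that contains a, yields c such that a divides c b and b
    divides (1 - c) a ([distributive_split]): either generator of (a, b)
    suffices on one piece of a partition of unity.  Refining such partitions one
    generator at a time ([partition_of_unity]) gives, for a finitely generated
    nonnil ideal I, elements e_i of sum 1 and non-nilpotent a_i in I with
    e_i I contained in (a_i).  The fractions e_i / a_i then lie in the inverse of
    the image of I, and the sum of the a_i (e_i / a_i) is 1. *)

Set Implicit Arguments.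
Unset Strict Implicit.
Unset Printing Implicit Defensive.

Import GRing.Theory.
Local Open Scope classical_set_scope.
Local Open Scope ring_scope.

(** * Finitely generated ideals *)

Section Ideals.
Variable A : comPzRingType.
Implicit Types (I : set A) (s : seq A).

Definition principal_ideal (a : A) : set A := [set x | exists z, x = z * a].

Lemma ideal_sum I n (F : 'I_n -> A) :
  is_ideal I -> (forall i, I (F i)) -> I (\sum_(i < n) F i).
Proof. by move=> [I0 ID _] IF; elim/big_ind: _. Qed.

Lemma idealN I x : is_ideal I -> I x -> I (- x).
Proof. by move=> [_ _ IM] /(IM (-1)); rewrite mulN1r. Qed.

Lemma ideal_gen_is_ideal s : is_ideal (ideal_gen s).
Proof.
split=> [|x y [a ->] [b ->]|r x [a ->]].
- by exists (fun=> 0); rewrite big1 // => i _; rewrite mul0r.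
- exists (fun i => a i + b i); rewrite -big_split.
  by apply: eq_bigr => i _; rewrite mulrDl.
- exists (fun i => r * a i); rewrite mulr_sumr.
  by apply: eq_bigr => i _; rewrite mulrA.
Qed.

Lemma mem_ideal_gen s x : x \in s -> ideal_gen s x.
Proof.
move=> xs; have lt_xs : (index x s < size s)%N by rewrite index_mem.
exists (fun i => (i == Ordinal lt_xs)%:R).
rewrite (bigD1 (Ordinal lt_xs)) //= eqxx mul1r nth_index // big1 ?addr0 //.
by move=> i /negPf->; rewrite mul0r.
Qed.

Lemma ideal_gen_sub I s :
  is_ideal I -> (forall x, x \in s -> I x) -> ideal_gen s `<=` I.
Proof.
move=> idI sI _ [a ->]; apply: ideal_sum => // i.
by case: idI => _ _; apply; apply: sI; exact: mem_nth.
Qed.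

Lemma ideal_gen2P (a b x : A) :
  ideal_gen [:: a; b] x -> exists r t, x = r * a + t * b.
Proof.
move=> [c ->]; rewrite big_ord_recl big_ord1.
by exists (c ord0), (c (lift ord0 ord0)).
Qed.

Lemma principal_is_ideal a : is_ideal (principal_ideal a).
Proof.
split=> [|_ _ [y ->] [z ->]|r _ [z ->]].
- by exists 0; rewrite mul0r.
- by exists (y + z); rewrite mulrDl.
- by exists (r * z); rewrite mulrA.
Qed.

Lemma principal_id a : principal_ideal a a.
Proof. by exists 1; rewrite mul1r. Qed.

Lemma is_ideal_colon I e : is_ideal I -> is_ideal [set y | I (e * y)].
Proof.
move=> [I0 ID IM]; split=> [|x y|r x] /=; first by rewrite mulr0.
  by rewrite mulrDr; exact: ID.
by rewrite mulrCA; exact: IM.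
Qed.

End Ideals.

(** * The total quotient ring and invertible ideals *)

Section TotalQuotient.
Variable A : comPzRingType.
Implicit Types I : set A.

Lemma regular_eq0 (u x : A) : u \in regular A -> u * x = 0 -> x = 0.
Proof.
by move=> /asboolP ru ux0; apply: contrapT => x0; apply: ru; exists x.
Qed.

Lemma to_total_quotient_inj : injective (@to_total_quotient A).
Proof.
move=> a b /mkfracP[u ru]; rewrite /= !mulr1 => e.
by apply/subr0_eq/(regular_eq0 ru); rewrite mulrBr e subrr.
Qed.

Lemma inv_ideal_lincomb I n (y : 'I_n -> total_quotient A) (c : 'I_n -> A) :
  (forall i, inv_ideal I (y i)) ->
  inv_ideal I (\sum_(i < n) to_total_quotient A (c i) * y i).
Proof.
move=> yI; elim/big_ind: _ => [a _|x z xI zI a Ia|i _ a Ia].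
- by exists 0; rewrite mul0r rmorph0.
- have [b eb] := xI a Ia; have [d ed] := zI a Ia.
  by exists (b + d); rewrite mulrDl eb ed rmorphD.
- by have [b eb] := yI i a Ia; exists (c i * b); rewrite -mulrA eb rmorphM.
Qed.

Lemma mul_inv_ideal_sub I :
  prod_set (to_total_quotient A @` I) (inv_ideal I)
  `<=` range (to_total_quotient A).
Proof.
move=> _ [n [x [y [xI yI ->]]]]; elim/big_ind: _ => [|_ _ [a _ <-] [b _ <-]|i _].
- by exists 0; rewrite ?rmorph0.
- by exists (a + b); rewrite ?rmorphD.
have [a Ia <-] := xI i; have [b eb] := yI i a Ia.
by exists b; rewrite // mulrC eb.
Qed.

(** The elements e_i / a_i lie in the inverse of I and witness that 1 belongs to
    the product of I with its inverse. *)
Lemma invertible_of_partition I n (a e : 'I_n -> A) :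
  (forall i, I (a i)) -> (forall i, a i \in regular A) ->
  \sum_(i < n) e i = 1 ->
  (forall i y, I y -> principal_ideal (a i) (e i * y)) ->
  invertible I.
Proof.
move=> aI areg e1 eI; apply/seteqP; split; first exact: mul_inv_ideal_sub.
move=> _ [r _ <-].
pose den_a i : den (regular A) := exist _ (a i) (areg i).
have mkfracM (p q : A) s : (mkfrac p s : total_quotient A) * to_total_quotient A q
    = mkfrac (p * q) s.
  rewrite [LHS](_ : _ = loc_mul (mkfrac p s) (mkfrac q (den1 _))) // loc_mulE.
  by apply: mkfrac_eq; rewrite /= mulr1.
exists n, (fun i => to_total_quotient A (a i)),
  (fun i => mkfrac (r * e i) (den_a i)).
split=> [i|i y Iy|]; first by exists (a i).
  have [z ez] := eI i y Iy; exists (r * z); rewrite mkfracM.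
  by apply: mkfrac_eq; rewrite /= mulr1 -mulrA ez mulrA.
rewrite -[r in LHS]mulr1 -e1 mulr_sumr rmorph_sum; apply: eq_bigr => i _.
by rewrite [RHS]mulrC mkfracM; apply: mkfrac_eq; rewrite /= mulr1.
Qed.

End TotalQuotient.

(** * Nilpotent elements of a phi-ring *)

Section PhiRing.
Variables (R : comNzRingType) (hR : phi_ring R).
Notation nil := (nilradical R).
Implicit Types I J K : set R.

Lemma nil_is_ideal : is_ideal nil.
Proof. by have [[]] := hR. Qed.

Lemma nil_prime x y : nil (x * y) -> ~ nil x -> nil y.
Proof. by have [[_ _ P] _] := hR => /P[]. Qed.

Lemma nil_sub_nonnil_ideal I : nonnil_ideal I -> nil `<=` I.
Proof. by move=> [idI nI]; have [_ /(_ I idI)[]] := hR. Qed.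

Lemma principal_nonnil a : ~ nil a -> nonnil_ideal (principal_ideal a).
Proof.
move=> na; split; first exact: principal_is_ideal.
by move=> /(_ a (principal_id a)).
Qed.

Lemma nil_principal a x : ~ nil a -> nil x -> principal_ideal a x.
Proof. by move=> /principal_nonnil/nil_sub_nonnil_ideal; apply. Qed.

Lemma phi_surj (y : phi_image hR) : exists x, phi hR x = y.
Proof.
by case: y => y yP; have /asboolP[x xy] := yP; exists x; apply: val_inj.
Qed.

Lemma phi_eq0 x : phi hR x = 0 <-> exists2 u, ~ nil u & u * x = 0.
Proof.
have -> : phi hR x = 0 <-> phi_mor hR x = phi_mor hR 0.
  rewrite rmorph0; split=> [/(congr1 val)//|e]; exact: val_inj.
rewrite mkfracP /=.
split=> -[u nu e]; exists u; [exact/asboolP | | exact/asboolP |].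
  by rewrite -[x]mulr1 e mul0r mulr0.
by rewrite mulr1 e mul0r mulr0.
Qed.

(** The kernel of [phi] lies in the nilradical because the latter is prime. *)
Lemma phi_eq_nil x y : phi hR x = phi hR y -> nil (x - y).
Proof.
move=> e; have /phi_eq0[u nu ux0] : phi hR (x - y) = 0.
  by rewrite rmorphB e subrr.
by apply: nil_prime nu; rewrite ux0; have [] := nil_is_ideal.
Qed.

Lemma phi_regular x : ~ nil x -> phi hR x \in regular (phi_image hR).
Proof.
move=> nx; apply/asboolP => -[y y0 xy0]; apply: y0; move: xy0.
have [z <-] := phi_surj y; rewrite -rmorphM => /phi_eq0[u nu e].
apply/phi_eq0; exists (u * x); last by rewrite -mulrA.
by move=> /nil_prime/(_ nu).
Qed.

(** * From invertibility to distributivity *)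

(** If p and q in the inverse of (j, k) satisfy p j + q k = 1, then a, b, c, d
    lift p j, p k, q j, q k. *)
Lemma phi_invertible_pair j k :
  phi_invertible hR (ideal_gen [:: j; k]) ->
  exists a b c d,
    [/\ nil (a + d - 1), nil (a * k - b * j) & nil (d * j - c * k)].
Proof.
move=> [_ inv]; set I := ideal_gen _ in inv.
pose t := to_total_quotient (phi_image hR).
have : range t 1 by exists 1; rewrite ?rmorph1.
rewrite -inv => -[n [x [y [xI yI e1]]]].
have /choice[r /choice[s xE]] i :
    exists r s, x i = t (phi hR r * phi hR j + phi hR s * phi hR k).
  have [_ [z Iz <-] <-] := xI i; have [r [s ->]] := ideal_gen2P Iz.
  by exists r, s; rewrite rmorphD !rmorphM.
pose p := \sum_(i < n) t (phi hR (r i)) * y i.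
pose q := \sum_(i < n) t (phi hR (s i)) * y i.
have lift u z : inv_ideal (phi hR @` I) u -> z \in [:: j; k] ->
    exists w, u * t (phi hR z) = t (phi hR w).
  move=> uI /mem_ideal_gen zI; have [|v] := uI (phi hR z); first by exists z.
  by have [w <-] := phi_surj v; exists w.
have pI : inv_ideal (phi hR @` I) p by exact: inv_ideal_lincomb.
have qI : inv_ideal (phi hR @` I) q by exact: inv_ideal_lincomb.
have [a ea] : exists a, p * t (phi hR j) = t (phi hR a).
  by apply: lift; rewrite ?inE ?eqxx.
have [b eb] : exists b, p * t (phi hR k) = t (phi hR b).
  by apply: lift; rewrite ?inE ?eqxx ?orbT.
have [c ec] : exists c, q * t (phi hR j) = t (phi hR c).
  by apply: lift; rewrite ?inE ?eqxx.
have [d ed] : exists d, q * t (phi hR k) = t (phi hR d).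
  by apply: lift; rewrite ?inE ?eqxx ?orbT.
have lift_eq u v : t (phi hR u) = t (phi hR v) -> nil (u - v).
  by move=> /to_total_quotient_inj/phi_eq_nil.
exists a, b, c, d; split; apply: lift_eq; rewrite !(rmorphD, rmorphM, rmorph1).
- rewrite -ea -ed e1 /p /q !mulr_suml -big_split; apply: eq_bigr => i _ /=.
  by rewrite xE !(rmorphD, rmorphM); ring.
- by rewrite -ea -eb; ring.
- by rewrite -ec -ed; ring.
Qed.

Lemma distributive_of_phi_prufer :
  phi_prufer hR -> nonnil_ideals_distributive R.
Proof.
move=> prufer I J K nI nJ nK; have [_ nilD nilM] := nil_is_ideal.
have [[_ ID IM] _] := nI; have [[J0 JD JM] _] := nJ; have [[K0 KD KM] _] := nK.
apply/seteqP; split=> [x [Ix [j Jj [k Kk xE]]]|_ [x [Ix Jx] [y [Iy Ky] <-]]]; last first.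
  split; first exact: ID.
  by exists x => //; exists y.
have nil_split z : nil z -> (I `&` J) z by split; exact: nil_sub_nonnil_ideal.
have [I0 _ _] := nI.1.
have [nilx|nx] := pselect (nil x).
  by exists x; [exact: nil_split | exists 0; rewrite ?addr0].
have njk : nonnil_ideal (ideal_gen [:: j; k]).
  split=> [|sub]; first exact: ideal_gen_is_ideal.
  apply: nx; rewrite -xE.
  by apply: nilD; apply/sub/mem_ideal_gen; rewrite !inE eqxx ?orbT.
have [|a [b [c [d [n1 nk nj]]]]] := @phi_invertible_pair j k.
  by apply: prufer => //; eexists.
have Ja : J (a * x).
  have -> : a * x = (a + b) * j + (a * k - b * j) by rewrite -xE; ring.
  by apply: JD; [exact: JM | exact: nil_sub_nonnil_ideal nk].
have Kd : K (d * x).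
  have -> : d * x = (c + d) * k + (d * j - c * k) by rewrite -xE; ring.
  by apply: KD; [exact: KM | exact: nil_sub_nonnil_ideal nj].
have [In Jn] : (I `&` J) (- (x * (a + d - 1))).
  by apply/nil_split/(idealN nil_is_ideal)/nilM.
(* The nilpotent defect of a + d = 1 is charged to the first summand. *)
exists (a * x - x * (a + d - 1)).
  by split; [apply: ID => //; exact: IM | exact: JD].
by exists (d * x); [split=> //; exact: IM | ring].
Qed.

(** * From distributivity to invertibility *)

(** Distributivity is applied to a = b + (a - b).  When a - b is nilpotent it
    does not apply, but then b divides a - b, hence a, and c = 0 works. *)
Lemma distributive_split a b :
  nonnil_ideals_distributive R -> ~ nil a -> ~ nil b ->
  exists c, principal_ideal a (c * b) /\ principal_ideal b ((1 - c) * a).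
Proof.
move=> distr na nb; have [nab|nab] := pselect (nil (a - b)).
  have [z ez] := nil_principal nb nab.
  exists 0; split; first by exists 0; rewrite !mul0r.
  by exists (z + 1); rewrite [RHS]mulrDl -ez; ring.
have : (principal_ideal a `&`
        ideal_add (principal_ideal b) (principal_ideal (a - b))) a.
  split; first exact: principal_id.
  exists b; first exact: principal_id.
  by exists (a - b); [exact: principal_id | rewrite addrC subrK].
rewrite distr; try exact: principal_nonnil.
move=> [t [_ [u tE]] [w [[v wE] [c wE']] e]].
exists c; split; first by exists (c - v); rewrite [RHS]mulrBl -wE wE'; ring.
exists (u - c); have -> : (1 - c) * a = t + w - c * a by rewrite e; ring.
by rewrite tE wE'; ring.
Qed.

(** When a non-nilpotent b is added to the generators, [distributive_split]
    cuts each piece e of the old partition, supported by a, into c e, where a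
    still suffices, and (1 - c) e, where b takes over; the latter parts are
    collected into a single piece supported by b.  A nilpotent b is a multiple of
    every a already present. *)
Lemma partition_of_unity x0 (s : seq R) :
  nonnil_ideals_distributive R -> ~ nil x0 ->
  exists t : seq (R * R),
    [/\ forall p, p \in t -> ~ nil p.1 /\ p.1 \in x0 :: s,
        \sum_(p <- t) p.2 = 1 &
        forall p y, p \in t -> y \in x0 :: s -> principal_ideal p.1 (p.2 * y)].
Proof.
move=> distr nx0; elim: s => [|b s [t [tnil t1 tdiv]]].
  exists [:: (x0, 1)]; split=> [p||p y]; rewrite ?big_seq1 ?inE //.
    by move=> /eqP->; rewrite eqxx.
  by move=> /eqP-> /eqP->; rewrite mul1r; exact: principal_id.
have mem_cons y : (y \in [:: x0, b & s]) = (y == b) || (y \in x0 :: s).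
  by rewrite !inE orbCA.
have [nilb|nb] := pselect (nil b).
  exists t; split=> // [p /tnil[np pt]|p y pt]; rewrite mem_cons.
    by rewrite pt orbT.
  move=> /orP[/eqP->|]; last exact: tdiv.
  by apply: nil_principal; [have [] := tnil _ pt | have [_ _] := nil_is_ideal; apply].
have /choice[c cP] a : exists c, ~ nil a ->
    principal_ideal a (c * b) /\ principal_ideal b ((1 - c) * a).
  have [nila|na] := pselect (nil a); first by exists 0.
  by have [c ?] := distributive_split distr na nb; exists c.
exists ((b, \sum_(p <- t) p.2 * (1 - c p.1))
        :: [seq (p.1, p.2 * c p.1) | p <- t]).
split=> [p||p y].
- rewrite inE => /orP[/eqP->|/mapP[q /tnil[nq qt] ->]]; rewrite mem_cons /=.
    by rewrite eqxx.
  by rewrite qt orbT.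
- rewrite big_cons big_map /= -big_split -[RHS]t1.
  by apply: eq_bigr => p _ /=; ring.
rewrite inE mem_cons => /orP[/eqP->|/mapP[q qt ->]] /=; last first.
  have [nq _] := tnil _ qt; have [_ _ qM] := principal_is_ideal q.1.
  move=> /orP[/eqP->|ys]; first by rewrite -mulrA; apply: qM; exact: (cP _ nq).1.
  by rewrite mulrAC mulrC; apply: qM; exact: tdiv.
have [b0 bD bM] := principal_is_ideal b.
move=> /orP[/eqP->|ys]; first by apply: bM; exact: principal_id.
rewrite mulr_suml big_seq; elim/big_ind: _ => // q qt.
have [nq _] := tnil _ qt; have [z ez] := tdiv _ _ qt ys.
have -> : q.2 * (1 - c q.1) * y = z * ((1 - c q.1) * q.1).
  transitivity ((1 - c q.1) * (q.2 * y)); first by ring.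
  by rewrite ez; ring.
by apply: bM; exact: (cP _ nq).2.
Qed.

Lemma phi_prufer_of_distributive :
  nonnil_ideals_distributive R -> phi_prufer hR.
Proof.
move=> distr I [s IE] nI; split=> //; have [_ notsub] := nI.
have [x0 x0s nx0] : exists2 x, x \in s & ~ nil x.
  apply: contrapT => nils; apply: notsub; rewrite IE.
  apply: ideal_gen_sub nil_is_ideal _ => x xs.
  by apply: contrapT => nx; apply: nils; exists x.
have mem_s y : (y \in x0 :: s) = (y \in s).
  by rewrite inE; case: eqP => [->|].
have [t [tnil t1 tdiv]] := partition_of_unity s distr nx0.
pose a (i : 'I_(size t)) := (nth (0, 0) t i).1.
pose e (i : 'I_(size t)) := (nth (0, 0) t i).2.
have t_i (i : 'I_(size t)) : nth (0, 0) t i \in t by exact: mem_nth.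
apply: (@invertible_of_partition _ _ _ (phi hR \o a) (phi hR \o e)).
- move=> i; exists (a i) => //; rewrite IE; apply: mem_ideal_gen.
  by rewrite -mem_s; have [] := tnil _ (t_i i).
- by move=> i; apply: phi_regular; have [] := tnil _ (t_i i).
- rewrite -rmorph_sum -(rmorph1 (phi hR)) -t1; congr (phi hR _).
  by rewrite (big_nth (0, 0)) big_mkord.
move=> i _ [y Iy <-].
have [z ez] : principal_ideal (a i) (e i * y).
  move: y Iy; rewrite IE.
  apply: ideal_gen_sub (is_ideal_colon _ (principal_is_ideal _)) _ => y.
  by rewrite -mem_s; exact: tdiv.
by exists (phi hR z); rewrite -rmorphM ez rmorphM.
Qed.

End PhiRing.

Theorem theorem2p4 (R : comNzRingType) (hR : phi_ring R) :
  phi_prufer hR <-> nonnil_ideals_distributive R.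
Proof.
split; first exact: distributive_of_phi_prufer.
exact: phi_prufer_of_distributive.
Qed.
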